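(* For no constant $\varepsilon>0$ does there exist a $\left(\frac{\sqrt5+1}{2}-\varepsilon\right)$-competitive online algorithm for $1|jrp,s=1,p_j=1,r_j|\sum w_jC_j+c_\mathcal{Q}$.
   Context: Problem $1|jrp,s=1,p_j=1,r_j|\sum w_jC_j+c_\mathcal{Q}$: jobs with processing time $1$, weights $w_j>0$ and nonnegative integer release dates $r_j$ must be processed non-preemptively on a single machine (at most one job at a time). There is a single resource, required by every job; each replenishment of it costs $K:=K_0+K_1\ge0$ (part of the instance). A solution consists of start times $S_j$ (completion times $C_j=S_j+1$) and replenishment times $t_1<\dots<t_q$; it is feasible if no two jobs overlap and for each job $j$ some replenishment time lies in $[r_j,S_j]$. Its cost is $\sum_jw_jC_j+qK$. Online setting: jobs are not known in advance (neither their number nor their data); a job, with its weight, becomes known at its release date, and replenishment and scheduling decisions cannot be revoked. An online algorithm is $c$-competitive if on every instance its cost is at most $c$ times the optimal offline cost. *)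

(* Defs.v *)
From mathcomp Require Import all_boot all_order all_algebra.
From mathcomp Require Import all_classical reals.

Set Implicit Arguments.
Unset Strict Implicit.
Unset Printing Implicit Defensive.

Import Order.TTheory GRing.Theory Num.Theory.
Local Open Scope classical_set_scope.
Local Open Scope ring_scope.

(* A job is a pair (release date, weight).  Its name is its position in the
   list [jobs]. *)
Record instance (R : realType) := Instance {
  repl_cost : R;
  jobs : seq (nat * R)
}.

Definition njobs (R : realType) (I : instance R) : nat := size (jobs I).

Definition release (R : realType) (I : instance R) (j : nat) : nat :=
  (nth (0%N, 0) (jobs I) j).1.

Definition weight (R : realType) (I : instance R) (j : nat) : R :=
  (nth (0%N, 0) (jobs I) j).2.

(* Jobs are numbered in order of release (ties in any order), so that the
   number of a released job reveals nothing about the unreleased ones. *)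
Definition valid_instance (R : realType) (I : instance R) : Prop :=
  [/\ 0 <= repl_cost I,
      forall j, (j < njobs I)%N -> 0 < weight I j
    & sorted leq [seq x.1 | x <- jobs I]].

(* [start] is only meaningful on the names j < njobs I. *)
Record solution (R : realType) := Solution {
  start : nat -> R;
  repl : seq R
}.

Definition completion (R : realType) (s : solution R) (j : nat) : R :=
  start s j + 1.

Definition feasible (R : realType) (I : instance R) (s : solution R) : Prop :=
  [/\ sorted <%R (repl s),
      forall i j, (i < njobs I)%N -> (j < njobs I)%N -> i <> j ->
        completion s i <= start s j \/ completion s j <= start s i
    & forall j, (j < njobs I)%N ->
        exists2 t, t \in repl s & (release I j)%:R <= t <= start s j].

Definition cost (R : realType) (I : instance R) (s : solution R) : R :=
  \sum_(j < njobs I) weight I j * completion s j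
  + (size (repl s))%:R * repl_cost I.

Definition opt_cost (R : realType) (I : instance R) : R :=
  inf [set cost I s | s in [set s | feasible I s]].

(* The jobs released up to and including time t; by the numbering convention
   this is a prefix of [jobs I], so it keeps the names. *)
Definition known_jobs (R : realType) (I : instance R) (t : R)
    : seq (nat * R) :=
  [seq x <- jobs I | x.1%:R <= t].

(* The decisions carried out up to time t are a function of the replenishment
   cost and of the jobs released up to time t: on two instances that look the
   same up to time t, the same jobs are started up to time t, at the same
   times, and the same replenishments are made up to time t. *)
Definition nonanticipative (R : realType) (A : instance R -> solution R)
    : Prop :=
  forall (I I' : instance R) (t : R),
    valid_instance I -> valid_instance I' ->
    repl_cost I = repl_cost I' -> known_jobs I t = known_jobs I' t ->
    (forall j u, (j < size (known_jobs I t))%N -> u <= t ->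
       start (A I) j = u <-> start (A I') j = u) /\
    [seq u <- repl (A I) | u <= t] = [seq u <- repl (A I') | u <= t].

Definition online_algorithm (R : realType) (A : instance R -> solution R)
    : Prop :=
  (forall I, valid_instance I -> feasible I (A I)) /\ nonanticipative A.

Definition competitive (R : realType) (c : R) (A : instance R -> solution R)
    : Prop :=
  forall I, valid_instance I -> cost I (A I) <= c * opt_cost I.

(* Main.v *)
(** The adversary releases a job of weight 1 at time 0, with a large
    replenishment cost K.  If the algorithm starts it at time S, the adversary
    either stops, so that the ratio is about (K + S) / K, or releases a second
    job of negligible weight right after S.  The latter forces a second
    replenishment, whereas a single late one serves both jobs, so that the
    ratio is about (2 K + S) / (K + S).  With x = (K + S) / K the two ratios
    are x and 1 + 1 / x, and one of them is at least the golden ratio. *)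

Require Import Defs.
From mathcomp Require Import all_boot all_order all_algebra.
From mathcomp Require Import all_classical reals.
From mathcomp Require Import lra.

Set Implicit Arguments.
Unset Strict Implicit.
Unset Printing Implicit Defensive.

Import Order.TTheory GRing.Theory Num.Theory.
Local Open Scope ring_scope.

Section OptimalCost.
Variable R : realType.
Implicit Types (I : instance R) (s : solution R).

Lemma feasible_release_le_start I s j :
  feasible I s -> (j < njobs I)%N -> (release I j)%:R <= start s j.
Proof. by move=> [_ _ ready] /ready[t _ /andP[]]; exact: le_trans. Qed.

Lemma cost_ge0 I s : valid_instance I -> feasible I s -> 0 <= cost I s.
Proof.
move=> [K0 w0 _] fs; apply: addr_ge0; last exact: mulr_ge0.
apply: sumr_ge0 => j _; apply: mulr_ge0; first exact/ltW/w0.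
by apply: addr_ge0 => //; exact: le_trans (feasible_release_le_start fs _).
Qed.

Lemma opt_cost_le I s :
  valid_instance I -> feasible I s -> opt_cost I <= cost I s.
Proof.
move=> vI fs; apply: ge_inf; last by exists s.
by exists 0 => _ [s' fs' <-]; exact: cost_ge0.
Qed.

Lemma opt_cost_ge0 I s : valid_instance I -> feasible I s -> 0 <= opt_cost I.
Proof.
move=> vI fs; apply: lb_le_inf; first by exists (cost I s), s.
by move=> _ [s' fs' <-]; exact: cost_ge0.
Qed.

(** Scaling up the ratio is harmless because the optimum is nonnegative. This allows the final
    argument to assume a ratio of at least 1. *)
Lemma competitiveW (c d : R) (A : instance R -> solution R) :
  (forall I, valid_instance I -> feasible I (A I)) ->
  c <= d -> competitive c A -> competitive d A.
Proof.
move=> fA le_cd cA I vI; apply: le_trans (cA I vI) _.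
by apply: ler_wpM2r => //; exact: opt_cost_ge0 (fA I vI).
Qed.

End OptimalCost.

Section Adversary.
Variables (R : realType) (K : R).
Hypothesis K_ge0 : 0 <= K.

Definition one_job : instance R := Instance K [:: (0%N, 1)].

Definition two_jobs (m : nat) (w : R) : instance R :=
  Instance K [:: (0%N, 1); (m, w)].

Lemma valid_one_job : valid_instance one_job.
Proof. by split=> // -[|j] // _; exact: ltr01. Qed.

Lemma valid_two_jobs m w : 0 < w -> valid_instance (two_jobs m w).
Proof. by move=> w0; split=> // -[|[|j]] // _; exact: ltr01. Qed.

Lemma cost_one_job s :
  cost one_job s = start s 0%N + 1 + (size (repl s))%:R * K.
Proof. by rewrite /cost big_ord1 mul1r. Qed.

Lemma cost_two_jobs m w s :
  cost (two_jobs m w) s = start s 0%N + 1 + w * (start s 1%N + 1)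
                          + (size (repl s))%:R * K.
Proof. by rewrite /cost big_ord_recl big_ord1 mul1r. Qed.

Lemma opt_one_job_le : opt_cost one_job <= K + 1.
Proof.
pose s := Solution (fun=> 0 : R) [:: 0].
have fs : feasible one_job s.
  split=> //; first by move=> [|i] [|j].
  by move=> [|j] // _; exists 0; rewrite ?mem_seq1 ?lexx.
apply: le_trans (opt_cost_le valid_one_job fs) _.
by rewrite cost_one_job /= add0r mul1r addrC.
Qed.

Lemma opt_two_jobs_le m w :
  0 < w -> opt_cost (two_jobs m w) <= K + (m%:R + 1) + w * (m%:R + 2).
Proof.
move=> w0.
(* Both jobs wait for a single replenishment at [m] and then run back to back. *)
pose s := Solution (fun j => m%:R + j%:R : R) [:: m%:R].
have fs : feasible (two_jobs m w) s.
  split=> //.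
    move=> [|[|i]] [|[|j]] //= _ _ _; rewrite /completion /= addr0;
      [by left|by right].
  move=> j j2; exists m%:R; rewrite ?mem_seq1 ?lerDl ?ler0n ?andbT //=.
  by rewrite ler_nat; case: j j2 => [|[|j]].
apply: le_trans (opt_cost_le (valid_two_jobs m w0) fs) _.
by rewrite cost_two_jobs /=; lra.
Qed.

Variable A : instance R -> solution R.
Hypothesis A_online : online_algorithm A.

Lemma cost_online_one_job :
  start (A one_job) 0%N + 1 + K <= cost one_job (A one_job).
Proof.
have [fA _] := A_online.
have [_ _ /(_ 0%N isT)[t t_repl _]] := fA _ valid_one_job.
rewrite cost_one_job lerD2l ler_peMl // ler1n.
by case: (repl _) t_repl.
Qed.

(** Up to time [S] the second job is invisible, so the algorithm repeats its one-job behaviour: a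
    replenishment by [S] and a start at [S]. The second job then needs another replenishment, at [m]
    or later. *)
Lemma cost_online_two_jobs m w : start (A one_job) 0%N < m%:R -> 0 < w ->
  start (A one_job) 0%N + 1 + 2 * K <= cost (two_jobs m w) (A (two_jobs m w)).
Proof.
set S := start _ _ => S_lt_m w0; have [fA nA] := A_online.
have v2 := valid_two_jobs m w0; have f2 := fA _ v2.
have [_ _ /(_ 0%N isT)[t1 t1_repl /andP[t1_ge0 t1_leS]]] := fA _ valid_one_job.
have S_ge0 : 0 <= S by exact: le_trans t1_leS.
have eqk : known_jobs one_job S = known_jobs (two_jobs m w) S.
  by rewrite /known_jobs /= S_ge0 leNgt S_lt_m.
have [same_start same_repl] := nA _ _ S valid_one_job v2 erefl eqk.
have start2 : start (A (two_jobs m w)) 0%N = S.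
  by apply/same_start => //; rewrite /known_jobs /= S_ge0.
have {}t1_repl : t1 \in repl (A (two_jobs m w)).
  have : t1 \in [seq u <- repl (A one_job) | u <= S].
    by rewrite mem_filter t1_leS.
  by rewrite same_repl mem_filter => /andP[].
have [_ _ /(_ 1%N isT)[t2 t2_repl /andP[m_le_t2 _]]] := f2.
have two_repl : (2 <= size (repl (A (two_jobs m w))))%N.
  apply: (@uniq_leq_size _ [:: t1; t2]).
    rewrite /= mem_seq1 andbT; apply/negP => /eqP t12.
    by have := lt_le_trans S_lt_m m_le_t2; rewrite -t12 ltNge t1_leS.
  by move=> t; rewrite !inE => /orP[] /eqP->.
(* The second job's nonnegative weighted completion time is dropped. *)
rewrite cost_two_jobs start2; apply: lerD.
  rewrite lerDl mulr_ge0 ?(ltW w0) // addr_ge0 //.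
  exact: le_trans (feasible_release_le_start f2 (isT : (1 < 2)%N)).
by apply: ler_wpM2r => //; rewrite ler_nat.
Qed.

(* Obtained by eliminating the start time S from the two inequalities
   S + 1 + K <= c (K + 1) and S + 1 + 2 K <= c (K + S + 3). *)
Lemma competitive_repl_cost_bound (c : R) :
  1 <= c -> competitive c A -> K * (1 + c - c ^+ 2) <= 3 * c - 1 + (c - 1) ^+ 2.
Proof.
move=> c_ge1 cA; have [fA _] := A_online; set S := start (A one_job) 0%N.
have S_ge0 : 0 <= S.
  exact: (feasible_release_le_start (fA _ valid_one_job) (isT : (0 < 1)%N)).
have c_ge0 : 0 <= c by exact: le_trans c_ge1.
have stop : S + 1 + K <= c * (K + 1).
  apply: le_trans cost_online_one_job _; apply: le_trans (cA _ valid_one_job) _.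
  exact: ler_wpM2l opt_one_job_le.
(* The least integer release date strictly after [S]. *)
pose m := (Num.truncn S).+1.
have S_lt_m : S < m%:R by exact: truncnS_gt.
have m_le_S1 : m%:R <= S + 1 by rewrite -natr1 lerD2r truncn_le.
(* With this weight the second job adds exactly 1 to the bound of [opt_two_jobs_le]. *)
pose w : R := (m%:R + 2)^-1.
have m2_gt0 : 0 < m%:R + 2 :> R by exact: ltr_wpDl.
have w_gt0 : 0 < w by rewrite invr_gt0.
have go_on : S + 1 + 2 * K <= c * (K + S + 3).
  apply: le_trans (cost_online_two_jobs S_lt_m w_gt0) _.
  apply: le_trans (cA _ (valid_two_jobs m w_gt0)) _.
  apply: ler_wpM2l => //; apply: le_trans (opt_two_jobs_le m w_gt0) _.
  by rewrite mulVf ?gt_eqF //; lra.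
(* In [go_on] the net coefficient of [S] is [c - 1]; scaling [stop] by it, which requires [1 <= c],
   makes [S] cancel. *)
have : (c - 1) * (S + 1 + K) <= (c - 1) * (c * (K + 1)).
  by apply: ler_wpM2l => //; lra.
by rewrite !expr2; nra.
Qed.

End Adversary.

Theorem theorem12 (R : realType) :
  ~ exists eps : R, 0 < eps /\
      exists A : instance R -> solution R,
        online_algorithm A /\ competitive ((Num.sqrt 5 + 1) / 2 - eps) A.
Proof.
move=> [eps [eps_gt0 [A [A_online]]]]; set c := _ - eps => cA.
(* For large [eps] the ratio [c] may fall below 1; [d] does not, and stays below the golden
   ratio. *)
pose d := Num.max c 1.
have dA : competitive d A.
  by apply: competitiveW cA; [case: A_online | rewrite le_max lexx].
have sqrt5_sq : Num.sqrt 5 ^+ 2 = 5 :> R by rewrite sqr_sqrtr.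
have sqrt5_ge0 : 0 <= Num.sqrt 5 :> R by exact: sqrtr_ge0.
have sqrt5_gt2 : 2 < Num.sqrt 5 :> R by rewrite expr2 in sqrt5_sq; nra.
have sqrt5_lt3 : Num.sqrt 5 < 3 :> R by rewrite expr2 in sqrt5_sq; nra.
have d_ge1 : 1 <= d by rewrite le_max lexx orbT.
have d_lt : d < (Num.sqrt 5 + 1) / 2.
  by rewrite gt_max; apply/andP; split; rewrite /c; lra.
have d_lt2 : d < 2 by lra.
(* The golden ratio is the larger root of [1 + x - x ^+ 2]. *)
have gap : 0 < 1 + d - d ^+ 2 by rewrite !expr2 in sqrt5_sq *; nra.
(* For this replenishment cost the bound reads [7 <= d ^+ 2 + d], whereas [d < 2] keeps the
   right-hand side below 6. *)
have K_ge0 : 0 <= 7 / (1 + d - d ^+ 2) by rewrite divr_ge0 // ltW.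
have := competitive_repl_cost_bound K_ge0 A_online d_ge1 dA.
by rewrite divfK ?gt_eqF // !expr2; nra.
Qed.
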